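(* Let $n\geq 6$ be an integer such that $\lfloor\frac n2\rfloor$ is odd. Then the alternating group $\mathcal A_n$, as a subgroup of $\mathcal S_n$, is nudgable.
   Context: $\mathcal S_n$ denotes the group of all permutations of $\{1,\ldots,n\}$ and $\mathcal A_n$ its subgroup of even permutations. For $\sigma\in\mathcal S_n$ the inversion set is $\mathrm{inv}(\sigma)=\{(i,j)\mid 1\leq i<j\leq n,\ \sigma(j)<\sigma(i)\}$. For a subgroup $G\subseteq\mathcal S_n$ and $\pi\in G$ put $D_G(\pi)=\{\sigma\in G\mid \mathrm{inv}(\sigma)\cap\mathrm{inv}(\pi)=\emptyset\}$. The subgroup $G\subseteq\mathcal S_n$ is called non-nudgable if $|D_G(\pi)|=|D_G(\pi^{-1})|$ for all $\pi\in G$; otherwise it is called nudgable. *)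

(* Defs.v *)
From mathcomp Require Import all_boot all_fingroup all_solvable.

Set Implicit Arguments.
Unset Strict Implicit.
Unset Printing Implicit Defensive.

Local Open Scope group_scope.

(* Permutations act on 'I_n = {0, ..., n-1} instead of {1, ..., n}; the shift
   by one preserves the order, hence inversions. *)
Definition invset (n : nat) (s : 'S_n) : {set 'I_n * 'I_n} :=
  [set p : 'I_n * 'I_n | (p.1 < p.2) && (s p.2 < s p.1)].

Definition DG (n : nat) (G : {group 'S_n}) (pi : 'S_n) : {set 'S_n} :=
  [set s in G | invset s :&: invset pi == set0].

Definition non_nudgable (n : nat) (G : {group 'S_n}) : Prop :=
  forall pi : 'S_n, pi \in G -> #|DG G pi| = #|DG G pi^-1|.

Definition nudgable (n : nat) (G : {group 'S_n}) : Prop := ~ non_nudgable G.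

(* Main.v *)
Require Import Defs.
From mathcomp Require Import all_boot all_fingroup all_solvable.
From mathcomp Require Import zify.

(** Let [w0] be the order-reversing permutation; it is odd when [n./2] is odd.
    The permutations whose inversions avoid those of [p := w * w0] are the [s]
    with [inv s \subset inv w].  The injection [s |-> p^-1 * s * w0] sends those
    avoiding [p] to those avoiding [p^-1], and for even [p] it exchanges
    parities.  So it is enough to find an odd [w] below which there are fewer
    even than odd permutations.  Take [w = 2 0 3 1] in one-line notation:
    exchanging the entries in positions 2 and 3 is a parity-reversing involution
    on the [s <> w] below [w]. *)

Set Implicit Arguments.
Unset Strict Implicit.
Unset Printing Implicit Defensive.

Local Open Scope group_scope.

Lemma invset_disjointP n (s p : 'S_n) :
  reflect (forall i j : 'I_n, i < j -> p j < p i -> s i < s j)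
          (invset s :&: invset p == set0).
Proof.
apply: (iffP eqP) => [dis i j lt_ij lt_p | H].
  have := in_set0 (i, j); rewrite -dis !inE /= lt_ij lt_p /= andbT => /negbT.
  rewrite -leqNgt leq_eqVlt => /orP[/eqP/ord_inj/perm_inj eq_ij|//].
  by rewrite eq_ij ltnn in lt_ij.
apply/setP => -[i j]; rewrite !inE /=; apply/negP.
by case/andP=> /andP[lt_ij +] /andP[_ /(H _ _ lt_ij)]; lia.
Qed.

Lemma in_DG n (G : {group 'S_n}) (p s : 'S_n) :
  (s \in DG G p) = (s \in G) && (invset s :&: invset p == set0).
Proof. by rewrite in_set. Qed.

(* [s i] counts the [j] with [s j < s i], and the inversions determine these. *)
Lemma invset_inj n : injective (@invset n).
Proof.
move=> s t eq_st.
have below (u : 'S_n) i : nat_of_ord (u i) = #|[set j | u j < u i]|.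
  rewrite -(card_imset _ (@perm_inj _ u)).
  have -> : u @: [set j | u j < u i] = [set k : 'I_n | k < u i].
    apply/setP => k; rewrite inE; apply/imsetP/idP => [[j]|lt_k].
      by rewrite inE => lt_j ->.
    by exists (u^-1 k); rewrite ?inE permKV.
  rewrite -sum1dep_card (big_ord_narrow (ltnW (ltn_ord _))).
  by rewrite sum1_card card_ord.
apply/permP => i; apply/val_inj; rewrite /= (below s) (below t).
congr #|pred_of_set _|.
apply/setP => j; rewrite !inE.
have inv_lt (a b : 'I_n) : a < b -> (s b < s a) = (t b < t a).
  by move=> lt_ab; move/setP/(_ (a, b)): eq_st; rewrite !inE /= lt_ab.
have neq_lt (u : 'S_n) (a b : 'I_n) : a < b -> (u a < u b) = ~~ (u b < u a).
  move=> lt_ab; rewrite -leqNgt [RHS]leq_eqVlt.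
  by case: eqP => // /ord_inj/perm_inj eq_ab; rewrite eq_ab ltnn in lt_ab.
case: (ltngtP j i) => [lt_ji|lt_ij|/ord_inj->]; last by rewrite !ltnn.
  by rewrite (neq_lt s) // (neq_lt t) // inv_lt.
exact: inv_lt.
Qed.

Definition rev_perm n : 'S_n := perm (@rev_ord_inj n).

Lemma rev_perm_lt n (i j : 'I_n) : (rev_perm n i < rev_perm n j) = (j < i).
Proof. by rewrite !permE /=; case: i j => i lt_i [j lt_j] /=; lia. Qed.

(** Sending [ord0] to [ord_max] adds [n] inversions to [rev_perm n], so the step from [n] to [n.+1]
    changes the sign by the parity of [n]. *)
Lemma odd_rev_perm n : rev_perm n = odd n./2 :> bool.
Proof.
elim: n => [|n IHn].
  by rewrite (_ : rev_perm 0 = 1) ?odd_perm1 //; apply/permP=> -[].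
have -> : rev_perm n.+1 = lift_perm ord0 ord_max (rev_perm n).
  apply/permP => i; case: (unliftP ord0 i) => [j ->|->].
    rewrite lift_perm_lift !permE; apply: val_inj.
    by rewrite /= /bump; have := ltn_ord j; lia.
  by rewrite lift_perm_id permE; apply: val_inj; rewrite /= subn1.
by rewrite odd_lift_perm IHn /= uphalf_half oddD oddb.
Qed.

(** If [a < b] is inverted by [p^-1], then [p^-1 b < p^-1 a] is a pair inverted by [p]; [s] keeps
    its order and [rev_perm n] flips it back. *)
Lemma invset_disjoint_inv n (s p : 'S_n) :
  invset s :&: invset p == set0 ->
  invset (p^-1 * s * rev_perm n) :&: invset p^-1 == set0.
Proof.
move=> /invset_disjointP dis; apply/invset_disjointP => a b lt_ab lt_p.
by rewrite !(permM _ (rev_perm n)) rev_perm_lt !permM dis // !permKV.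
Qed.

Lemma leq_card_odd_DG_inv n (p : 'S_n) :
  odd n./2 -> ~~ odd_perm p ->
  #|[set s : 'S_n in DG [set: 'S_n] p | odd_perm s]| <= #|DG 'Alt_('I_n) p^-1|.
Proof.
move=> odd_n even_p.
have inj_f : injective (fun s => p^-1 * s * rev_perm n).
  by move=> s t /mulIg/mulgI.
rewrite -(card_imset _ inj_f).
apply/subset_leq_card/subsetP => _ /imsetP[s + ->].
rewrite in_set !in_DG in_setT => /andP[dis odd_s].
rewrite invset_disjoint_inv // andbT.
rewrite Alt_even !odd_permM odd_permV odd_rev_perm odd_n odd_s.
by rewrite (negbTE even_p).
Qed.

Section Witness.

Variable n : nat.

Let x0 : 'I_n.+4 := @Ordinal n.+4 0 isT.
Let x1 : 'I_n.+4 := @Ordinal n.+4 1 isT.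
Let x2 : 'I_n.+4 := @Ordinal n.+4 2 isT.
Let x3 : 'I_n.+4 := @Ordinal n.+4 3 isT.

Definition perm2031 : 'S_n.+4 := tperm x0 x1 * tperm x2 x3 * tperm x1 x2.

(** The default value [i] of [nth] covers the points from 4 on, which are fixed. *)
Lemma perm2031E i :
  perm2031 i = nth (nat_of_ord i) [:: 2; 0; 3; 1]%N i :> nat.
Proof.
rewrite !permM !permE /=.
by case: i => -[|[|[|[|i]]]] lt_i //=; rewrite nth_default.
Qed.

Lemma odd_perm2031 : odd_perm perm2031.
Proof. by rewrite !odd_permM !odd_tperm. Qed.

Lemma tperm23E i :
  tperm x2 x3 i = nth (nat_of_ord i) [:: 0; 1; 3; 2]%N i :> nat.
Proof.
rewrite permE /=.
by case: i => -[|[|[|[|i]]]] lt_i //=; rewrite nth_default.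
Qed.

Definition below2031 (s : 'S_n.+4) :=
  forall i j : 'I_n.+4, i < j -> perm2031 i < perm2031 j -> s i < s j.

(** The order-preserved pairs of [perm2031] within the first four positions are (0,2), (1,2), (1,3).
    The swap exchanges the last two and turns (0,2) into (0,3), which the hypothesis on [s]
    handles. *)
Lemma below2031_tperm s :
  below2031 s -> s x0 < s x3 -> below2031 (tperm x2 x3 * s).
Proof.
move=> below_s lt03 i j lt_ij lt_w; rewrite !permM.
have [[/ord_inj-> /ord_inj->]|neq] :
    (i = x0 :> nat /\ j = x2 :> nat) \/ ~~ ((i == 0 :> nat) && (j == 2 :> nat)).
- by case: (boolP (_ && _)) => [/andP[/eqP-> /eqP->]|]; [left | right].
- by rewrite tpermL tpermD.
have [lt_tij lt_wt] : tperm x2 x3 i < tperm x2 x3 j /\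
    perm2031 (tperm x2 x3 i) < perm2031 (tperm x2 x3 j).
  move: lt_ij lt_w neq; rewrite !perm2031E !tperm23E.
  case: i j => -[|[|[|[|i]]]] lt_i [[|[|[|[|j]]]] lt_j] //=;
    by rewrite ?nth_default.
exact: below_s.
Qed.

Lemma below2031_eq s : below2031 s -> s x3 < s x0 -> s = perm2031.
Proof.
move=> below_s lt30; apply/invset_inj/setP => -[i j]; rewrite !inE /=.
case lt_ij: (i < j) => //=.
(* These give the chain [s x1 < s x3 < s x0 < s x2], which forces every inversion of [perm2031] on
   [s]. *)
have lt02 : s x0 < s x2 by apply: below_s; rewrite ?perm2031E.
have lt13 : s x1 < s x3 by apply: below_s; rewrite ?perm2031E.
apply/idP/idP => [lt_s|lt_w].
  rewrite ltnNge; apply/negP; rewrite leq_eqVlt => /orP[/eqP/ord_inj/perm_inj|].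
    by move=> eq_ij; rewrite eq_ij ltnn in lt_ij.
  by move/(below_s _ _ lt_ij); rewrite ltnNge ltnW.
have [[/ord_inj-> /ord_inj->]|[/ord_inj-> /ord_inj->]|[/ord_inj-> /ord_inj->]] :
    [\/ i = x0 :> nat /\ j = x1 :> nat, i = x0 :> nat /\ j = x3 :> nat
      | i = x2 :> nat /\ j = x3 :> nat].
- move: lt_ij lt_w; rewrite !perm2031E.
  by case: i j => -[|[|[|[|i]]]] lt_i [[|[|[|[|j]]]] lt_j] //=;
    rewrite ?nth_default //= => *;
    first [by constructor 1 | by constructor 2 | by constructor 3 | by lia].
- exact: ltn_trans lt13 lt30.
- exact: lt30.
- exact: ltn_trans lt30 lt02.
Qed.

Lemma disjoint2031P s :
  reflect (below2031 s)
          (invset s :&: invset (perm2031 * rev_perm n.+4) == set0).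
Proof.
by apply: (iffP (invset_disjointP _ _)) => H i j lt_ij;
  have := H i j lt_ij; rewrite !(permM perm2031) rev_perm_lt.
Qed.

Lemma card_even_lt_odd_2031 (p := perm2031 * rev_perm n.+4) :
  #|DG 'Alt_('I_n.+4) p| <
  #|[set s : 'S_n.+4 in DG [set: 'S_n.+4] p | odd_perm s]|.
Proof.
have Dw : perm2031 \in [set s : 'S_n.+4 in DG [set: 'S_n.+4] p | odd_perm s].
  by rewrite in_set in_DG in_setT odd_perm2031 andbT; apply/disjoint2031P.
(* Strictness comes from setting [perm2031] aside: the swap injects the even permutations into the
   remaining odd ones. *)
rewrite [X in _ < X](cardsD1 perm2031) Dw add1n ltnS.
rewrite -(card_imset _ (mulgI (tperm x2 x3))).
apply/subset_leq_card/subsetP => _ /imsetP[s + ->].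
rewrite in_DG Alt_even => /andP[even_s /disjoint2031P below_s].
have lt03 : s x0 < s x3.
  rewrite ltnNge leq_eqVlt; apply/negP => /orP[/eqP/ord_inj/perm_inj //|].
  by move/(below2031_eq below_s)=> eq_s; rewrite eq_s odd_perm2031 in even_s.
rewrite in_setD1 in_set in_DG in_setT; apply/and3P; split.
(* The swapped permutation takes the values [s x0 < s x2] at [x0] and [x3], a pair that [perm2031]
   inverts. *)
- apply/eqP => eq_w.
  have lt02 : s x0 < s x2 by apply: below_s; rewrite ?perm2031E.
  have : perm2031 x3 < perm2031 x0 by rewrite !perm2031E.
  by rewrite -eq_w !permM tpermR tpermD // ltnNge (ltnW lt02).
- exact/disjoint2031P/below2031_tperm.
by rewrite odd_permM odd_tperm.
Qed.

End Witness.

Theorem proposition3p3 (n : nat) (hn : 6 <= n) (hodd : odd (n %/ 2)) :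
  nudgable ('Alt_('I_n))%G.
Proof.
case: n hn hodd => [|[|[|[|n]]]] // _; rewrite divn2 => odd_n.
pose p := perm2031 n * rev_perm n.+4.
have even_p : ~~ odd_perm p.
  by rewrite odd_permM odd_perm2031 odd_rev_perm odd_n.
move=> /(_ p); rewrite Alt_even even_p => /(_ isT) eq_card.
(* The odd permutations avoiding [p] outnumber the even ones, yet inject into the even ones avoiding
   [p^-1]. *)
have := leq_trans (card_even_lt_odd_2031 n) (leq_card_odd_DG_inv odd_n even_p).
by rewrite -eq_card ltnn.
Qed.
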